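(* Let $1<p<\infty$ and let $q$ be such that $\frac1p+\frac1q=1$. The following hold. (1) $B_\infty^p$ has the r-BSP. (2) Every slice of the closed unit ball of $B_\infty^p$ has diameter greater than or equal to $2^{1/q}$. (3) For every $\varepsilon>0$ there exists a slice $S$ of the closed unit ball of $B_\infty^p$ such that $\operatorname{diam}(S)\leq 2^{1/q}+\varepsilon$.
   Context: All Banach spaces are real. Let $T_\infty$ be the set of all finite sequences of natural numbers, including the empty sequence $\emptyset$, ordered by: $t\leq s$ if and only if $t$ is an initial segment of $s$ (so $\emptyset\leq s$ for all $s$). A segment of $T_\infty$ is a nonempty finite totally ordered subset $S\subseteq T_\infty$ which is an interval: if $s,u\in S$, $t\in T_\infty$ and $s\leq t\leq u$, then $t\in S$. For a finitely supported $x:T_\infty\to\mathbb R$ put $\|x\|=\sup\left(\sum_{i=1}^n\left|\sum_{t\in S_i}x(t)\right|^p\right)^{1/p}$, the supremum being taken over all finite families $\{S_1,\ldots,S_n\}$ of pairwise disjoint segments. $JT_\infty^p$ is the completion of the space of finitely supported functions on $T_\infty$ for this norm. For $t\in T_\infty$, $e_t$ is the indicator function of $\{t\}$ and $e_t^*\in(JT_\infty^p)^*$ is the continuous functional determined by $e_t^*(x)=x(t)$ on finitely supported $x$. $B_\infty^p:=\overline{\operatorname{span}}\{e_t^*:t\in T_\infty\}\subseteq(JT_\infty^p)^*$ (norm closure). A slice of the closed unit ball $B_X$ of a Banach space $X$ is a set $\{x\in B_X:x^*(x)>1-\alpha\}$ with $x^*\in S_{X^*}$ (the unit sphere of $X^*$)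 and $\alpha>0$. $X$ has the r-big slice property (r-BSP) if $\inf\{r>0:S\subseteq B(x,r)\text{ for some }x\in X\}\geq1$ for every slice $S$ of $B_X$, where $B(x,r)$ is the ball of centre $x$ and radius $r$. *)

(* Defs.v *)
From HB Require Import structures.
From mathcomp Require Import all_boot all_order all_algebra finmap.
From mathcomp Require Import all_classical all_reals all_analysis.

Set Implicit Arguments.
Unset Strict Implicit.
Unset Printing Implicit Defensive.

Import Order.TTheory GRing.Theory Num.Theory.
Import numFieldNormedType.Exports.

Local Open Scope classical_set_scope.
Local Open Scope ring_scope.

(* The topological dual of V. *)
Section Dual.
Context {R : realType} (V : normedModType R).

Definition continuous_functional : {pred V -> R^o} :=
  fun f => `[< linear f /\ continuous (f : V -> R) >].

Lemma continuous_functional_submod_closed :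
  submod_closed continuous_functional.
Proof.
split.
  apply/asboolP; split=> [a u v|]; first by rewrite /= scaler0 addr0.
  exact: cst_continuous.
move=> a f g /asboolP[fl fc] /asboolP[gl gc]; apply/asboolP; split.
  move=> b u v; rewrite !fctE fl gl !scalerDr !scalerA (mulrC b a).
  by rewrite addrACA.
move=> x; apply: (@continuousD _ R^o V (a *: f) g); last exact: gc.
by apply: (@continuousZl_tmp _ R^o V f a x); exact: fc.
Qed.

HB.instance Definition _ := GRing.isSubmodClosed.Build R (V -> R^o)
  continuous_functional continuous_functional_submod_closed.

Record dual := Dual {
  dual_fun :> V -> R^o;
  _ : dual_fun \in continuous_functional }.

HB.instance Definition _ := [isSub for dual_fun].
HB.instance Definition _ := [Choice of dual by <:].
HB.instance Definition _ := [SubChoice_isSubLmodule of dual by <:].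

Lemma dual_linear (f : dual) : linear f.
Proof. by case: f => f /= /asboolP[]. Qed.

HB.instance Definition _ (f : dual) :=
  GRing.isLinear.Build R V R^o _ f (dual_linear f).

Lemma dual_continuous (f : dual) : continuous (f : V -> R).
Proof. by case: f => f /= /asboolP[]. Qed.

Definition dual_norm (f : dual) : R :=
  sup [set `|f x : R| | x in [set x : V | `|x| <= 1]].

Lemma dual_norm_has_sup (f : dual) :
  has_sup [set `|f x : R| | x in [set x : V | `|x| <= 1]].
Proof.
split; first by exists `|f 0 : R|, 0 => //=; rewrite normr0.
have /(@continuous_linear_bounded _ V R^o 0 f) := @dual_continuous f 0.
move/(bounded_funP f) => /(_ 1)[M Mf].
by exists M => _ [x /= x1 <-]; exact: Mf.
Qed.

Lemma dual_norm_ub (f : dual) (x : V) : `|x| <= 1 -> `|f x : R| <= dual_norm f.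
Proof.
by move=> x1; apply: sup_upper_bound (dual_norm_has_sup f) _ _; exists x.
Qed.

Lemma dual_norm_lub (f : dual) (M : R) :
  (forall x : V, `|x| <= 1 -> `|f x : R| <= M) -> dual_norm f <= M.
Proof.
move=> fM; apply: ge_sup; first exact: (dual_norm_has_sup f).1.
by move=> _ [x /= x1 <-]; exact: fM.
Qed.

Lemma dual_norm_ge0 (f : dual) : 0 <= dual_norm f.
Proof.
by apply: le_trans (dual_norm_ub f (x := 0) _); rewrite ?normr0.
Qed.

Lemma dual_normD (f g : dual) : dual_norm (f + g) <= dual_norm f + dual_norm g.
Proof.
apply: dual_norm_lub => x x1; apply: le_trans (ler_normD (f x) (g x)) _.
by apply: lerD; exact: dual_norm_ub.
Qed.

Lemma dual_normZ (l : R) (f : dual) : dual_norm (l *: f) = `|l| * dual_norm f.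
Proof.
have le k h : dual_norm (k *: h) <= `|k| * dual_norm h.
  apply: dual_norm_lub => x x1; rewrite [X in `|X|]/(k * h x) normrM.
  by rewrite ler_wpM2l// dual_norm_ub.
apply/eqP; rewrite eq_le le/=; have [->|l0] := eqVneq l 0.
  by rewrite normr0 mul0r dual_norm_ge0.
rewrite -ler_pdivlMl ?normr_gt0// -normfV.
by rewrite -{1}[f](@scalerK _ _ l) ?unitfE// le.
Qed.

Lemma dual_norm0_eq0 (f : dual) : dual_norm f = 0 -> f = 0.
Proof.
move=> f0; apply/val_inj/funext => x /=.
have [->|x0] := eqVneq x 0; first by rewrite linear0.
have nx0 : `|x| != 0 by rewrite normr_eq0.
have : `|f (`|x|^-1 *: x) : R| <= 0.
  by rewrite -f0 dual_norm_ub// normrZ normfV normr_id mulVf.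
rewrite normr_le0 linearZ /= mulf_eq0 invr_eq0 (negPf nx0)/= => /eqP ->.
by [].
Qed.

HB.instance Definition _ := Lmodule_isNormed.Build R dual
  dual_normD dual_normZ dual_norm0_eq0.

End Dual.

(* [cspan A] is the norm-closed linear span of A, with the norm of V *)
Section ClosedSpan.
Context {R : realType} (V : normedModType R) (A : set V).

Definition lin_span : set V :=
  [set v | exists2 s : seq (R * V),
    forall c, c \in s -> A c.2 & v = \sum_(c <- s) c.1 *: c.2].

Definition closed_span : {pred V} := fun v => `[< closure lin_span v >].

Lemma lin_spanP (a : R) (u v : V) :
  lin_span u -> lin_span v -> lin_span (a *: u + v).
Proof.
move=> [s sA ->] [t tA ->]; exists ([seq (a * c.1, c.2) | c <- s] ++ t).
  move=> c; rewrite mem_cat => /orP[/mapP[d ds ->]|ct]; [exact: (sA d)|exact: tA].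
rewrite big_cat big_map scaler_sumr; congr (_ + _).
by apply: eq_bigr => c _; rewrite scalerA.
Qed.

Lemma closed_span_submod_closed : submod_closed closed_span.
Proof.
split.
  apply/asboolP/subset_closure; exists [::]; first by [].
  by rewrite big_nil.
move=> a u v /asboolP uA /asboolP vA; apply/asboolP => B.
have /(_ B) : (fun z : V * V => a *: z.1 + z.2) @ (u, v) --> a *: u + v.
  apply: cvgD; last exact: cvg_snd.
  by apply: cvgZl_tmp; exact: cvg_fst.
move=> /[apply] -[[U W] /= [/uA[x [xA xU]] /vA[y [yA yW]]] UWB].
exists (a *: x + y); split; first exact: lin_spanP.
exact: (UWB (x, y)).
Qed.

HB.instance Definition _ := GRing.isSubmodClosed.Build R V
  closed_span closed_span_submod_closed.

Record cspan := CSpan {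
  cspan_val :> V;
  _ : cspan_val \in closed_span }.

HB.instance Definition _ := [isSub for cspan_val].
HB.instance Definition _ := [Choice of cspan by <:].
HB.instance Definition _ := [SubChoice_isSubLmodule of cspan by <:].

Definition cspan_norm (u : cspan) : R := `|cspan_val u|.

Lemma cspan_normD (u v : cspan) :
  cspan_norm (u + v) <= cspan_norm u + cspan_norm v.
Proof. exact: ler_normD. Qed.

Lemma cspan_normZ (l : R) (u : cspan) :
  cspan_norm (l *: u) = `|l| * cspan_norm u.
Proof. exact: normrZ. Qed.

Lemma cspan_norm0_eq0 (u : cspan) : cspan_norm u = 0 -> u = 0.
Proof. by move=> /normr0_eq0 u0; exact/val_inj. Qed.

HB.instance Definition _ := Lmodule_isNormed.Build R cspan
  cspan_normD cspan_normZ cspan_norm0_eq0.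

End ClosedSpan.

Section Slices.
Context {R : realType} (V : normedModType R).

Definition slice (f : dual V) (a : R) : set V :=
  [set x | `|x| <= 1 /\ 1 - a < (f x : R)].

Definition is_slice (S : set V) : Prop :=
  exists (f : dual V) (a : R), [/\ `|f| = 1, 0 < a & S = slice f a].

Definition covering_radius (S : set V) : R :=
  inf [set r : R | 0 < r /\ exists x : V, S `<=` closed_ball x r].

Definition r_BSP : Prop := forall S, is_slice S -> 1 <= covering_radius S.

Definition diam (S : set V) : R :=
  sup [set `|x - y| | x in S & y in S].

End Slices.

Section FiniteSupport.
Context (T : Type) (R : realType).

Definition finite_support : {pred T -> R^o} :=
  fun x => `[< finite_set [set t | x t != 0] >].

Lemma finite_support_submod_closed : submod_closed finite_support.
Proof.
split.
  apply/asboolP; rewrite (_ : [set _ | _] = set0); first exact: finite_set0.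
  by apply/seteqP; split=> t //=; rewrite eqxx.
move=> a x y /asboolP xf /asboolP yf; apply/asboolP.
have : finite_set ([set t | x t != 0] `|` [set t | y t != 0]).
  by rewrite finite_setU.
apply: sub_finite_set => t /=; rewrite !fctE; apply: contraPP.
move=> /not_orP[/negP]; rewrite negbK => /eqP -> /negP; rewrite negbK => /eqP ->.
by rewrite scaler0 addr0 eqxx.
Qed.

HB.instance Definition _ := GRing.isSubmodClosed.Build R (T -> R^o)
  finite_support finite_support_submod_closed.

Record c00 := C00 {
  c00_fun :> T -> R^o;
  _ : c00_fun \in finite_support }.

HB.instance Definition _ := [isSub for c00_fun].
HB.instance Definition _ := [Choice of c00 by <:].
HB.instance Definition _ := [SubChoice_isSubLmodule of c00 by <:].

End FiniteSupport.

(* The tree is [seq nat], ordered by [prefix] *)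
Definition segment (S : {fset seq nat}) : Prop :=
  [/\ S != fset0,
      {in S &, forall s t, prefix s t || prefix t s} &
      forall s t u, s \in S -> u \in S -> prefix s t -> prefix t u -> t \in S].

Definition segment_family (F : seq {fset seq nat}) : Prop :=
  (forall S, S \in F -> segment S) /\
  pairwise (fun S S' => [disjoint S & S']%fset) F.

Section JamesTree.
Context {R : realType}.

Definition jt_norm (p : R) (x : c00 (seq nat) R) : R :=
  sup [set (\sum_(S <- F) `|\sum_(t <- S) (x t : R)| `^ p) `^ p^-1
      | F in segment_family].

(* A completion of the normed space (c00, jt_norm p): a Banach space X together
   with a linear isometry of c00 onto a dense subspace; it is unique up to
   isometric isomorphism fixing c00. *)
Definition is_JT (p : R) (X : completeNormedModType R)
    (J : {linear c00 (seq nat) R -> X}) : Prop :=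
  (forall x, `|J x| = jt_norm p x) /\ closure (range J) = setT.

(* { e_t^* : t in the tree }; by density of the range of J, at most one f
   satisfies the condition for each t. *)
Definition coord_functionals (X : completeNormedModType R)
    (J : {linear c00 (seq nat) R -> X}) : set (dual X) :=
  [set f | exists t, forall x, f (J x) = x t].

Definition B_infty (X : completeNormedModType R)
  (J : {linear c00 (seq nat) R -> X}) : normedModType R :=
  cspan (coord_functionals J).

End JamesTree.

(* Main.v *)
(* A family of disjoint segments S and weights a_S with sum |a_S|^q <= 1 gives a functional
   sum a_S 1_S of norm at most one, and these functionals norm the dual of B_infty, because the
   projection on a finite prefix-closed set of nodes maps segments to segments. In a slice one
   therefore finds such a functional; adding to each S a child n of its last node keeps the segments
   disjoint when n is fresh, and keeps the functional m_n in the slice for suitable large n, since a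
   bounded functional is small on sum a_S e_(S,n)^*. The new nodes form an antichain, on which the
   norm of JT is the l_p norm. Testing on the vector u_n supported there, dual to a, gives
   |m_n - z| >= 1 - o(1) for any fixed z in B_infty, and testing m_n - m_k on u_n - u_k gives
   |m_n - m_k| >= 2 / 2^(1/p) = 2^(1/q).

   For the small slice take the functionals x in the unit ball with x(root) close to one, and
   compare them on K e_root + u and K e_root - u: for large K these norms are K plus the largest sums
   of u and of -u over segments through the root, and two such segments differ by two disjoint
   segments. *)
Require Import Defs.
From HB Require Import structures.
From mathcomp Require Import all_boot all_order all_algebra finmap.
From mathcomp Require Import all_classical all_reals all_analysis.
From mathcomp Require Import ring lra.
Import Order.TTheory GRing.Theory Num.Theory.
Import numFieldNormedType.Exports.
Set Implicit Arguments.
Unset Strict Implicit.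
Unset Printing Implicit Defensive.
Local Open Scope classical_set_scope.
Local Open Scope ring_scope.

(** * Superadditivity of powers *)

Section PowerSums.
Context {R : realType}.
Implicit Types (p x y : R).

Lemma powR_superadditive p x y : 1 < p -> 0 <= x -> 0 <= y ->
  x `^ p + y `^ p <= (x + y) `^ p.
Proof.
move=> p1 x0 y0; have p0 : 0 < p by lra.
rewrite -(mulr_powRB1 x0 p0) -(mulr_powRB1 y0 p0) -(mulr_powRB1 (addr_ge0 x0 y0) p0).
rewrite mulrDl.
by apply: lerD; apply: ler_wpM2l => //; apply: ge0_ler_powR; rewrite ?nnegrE; lra.
Qed.

Lemma sum_powR_le (I : Type) (s : seq I) (F : I -> R) p : 1 < p ->
  (forall i, 0 <= F i) -> \sum_(i <- s) F i `^ p <= (\sum_(i <- s) F i) `^ p.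
Proof.
move=> p1 F0; elim: s => [|i s IHs].
  by rewrite !big_nil powR0//; lra.
rewrite !big_cons; apply: le_trans (powR_superadditive p1 _ _) => //.
  by rewrite lerD2l.
exact: sumr_ge0.
Qed.

End PowerSums.

(** * The James tree norm as a supremum over segment families *)

Section JamesNorm.
Context {R : realType}.
Implicit Types (p : R) (x : c00 (seq nat) R) (F : seq {fset seq nat}).

Lemma segment_family_sum_mem F (t : seq nat) : segment_family F ->
  \sum_(S <- F) (t \in S)%:R <= 1 :> R.
Proof.
case=> _; elim: F => [|S F IHF] /=; first by rewrite big_nil.
rewrite big_cons => /andP[/allP dS /IHF ub]; case: (boolP (t \in S)) => tS.
  rewrite big1_seq ?addr0// => S' /= /dS /fdisjointP/(_ _ tS).
  by move=> /negPf ->.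
by rewrite add0r.
Qed.

(** Moves a sum over a segment to the fixed support of [f], so that it can be exchanged with the sum
    over a family. *)
Lemma sum_restrict (T : choiceType) (S s : seq T) (f : T -> R) :
  uniq S -> uniq s -> (forall t, t \notin s -> f t = 0) ->
  \sum_(t <- S) f t = \sum_(t <- s) (t \in S)%:R * f t.
Proof.
move=> uS us fs; rewrite (bigID (mem s)) /= addrC big1 ?add0r; last first.
  by move=> t /fs.
rewrite [RHS](bigID (mem S)) /= [X in _ = _ + X]big1 ?addr0; last first.
  by move=> t /negPf ->; rewrite mul0r.
rewrite [RHS](eq_bigr f); last by move=> t ->; rewrite mul1r.
rewrite -big_filter -[RHS]big_filter; apply/perm_big/uniq_perm; rewrite ?filter_uniq// => t.
by rewrite !mem_filter andbC.
Qed.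

Lemma segment_family_sum_le F (s : seq (seq nat)) (f : seq nat -> R) :
  segment_family F -> uniq s -> (forall t, 0 <= f t) ->
  (forall t, t \notin s -> f t = 0) ->
  \sum_(S <- F) \sum_(t <- S) f t <= \sum_(t <- s) f t.
Proof.
move=> Ff us f0 fs.
rewrite (eq_bigr _ (fun S _ => sum_restrict (fset_uniq S) us fs)) exchange_big /=.
apply: ler_sum => t _; rewrite -mulr_suml -[leRHS]mul1r.
by rewrite ler_wpM2r// segment_family_sum_mem.
Qed.

(** The l_1 norm of [x] bounds all family sums. Without such a bound [sup] could be the default
    value 0 instead of a genuine supremum. *)
Lemma jt_norm_has_sup p x : 1 < p -> has_sup
  [set (\sum_(S <- F) `|\sum_(t <- S) (x t : R)| `^ p) `^ p^-1
      | F in segment_family].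
Proof.
move=> p1; have p0 : 0 < p by lra.
split; first by eexists; exists [::]; split.
have /asboolP fx : c00_fun x \in @Defs.finite_support (seq nat) R by case: x.
pose s := fset_set [set t | x t != 0 :> R].
have xs t : t \notin s -> (x t : R) = 0.
  by rewrite in_fset_set// notin_setE /= => /negP; rewrite negbK => /eqP.
exists (\sum_(t <- s) `|x t : R|) => _ [F Ff <-].
rewrite -[leRHS]powRr1 ?sumr_ge0// -(mulfV (lt0r_neq0 p0)) powRrM.
apply: ge0_ler_powR; rewrite ?nnegrE ?powR_ge0 ?invr_ge0 ?(ltW p0)//.
  by apply: sumr_ge0 => S _; exact: powR_ge0.
apply: le_trans (sum_powR_le _ p1 _) _ => //.
apply: ge0_ler_powR; rewrite ?nnegrE ?(ltW p0) ?sumr_ge0//.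
apply: le_trans (@segment_family_sum_le F s (fun t => `|x t : R|) Ff (fset_uniq s) _ _) => //.
  by apply: ler_sum => S _; exact: ler_norm_sum.
by move=> t /xs ->; rewrite normr0.
Qed.

Lemma jt_norm_ge0 p x : 1 < p -> 0 <= jt_norm p x.
Proof.
move=> p1; apply: (sup_upper_bound (jt_norm_has_sup x p1)).
exists [::]; first by split.
by rewrite big_nil powR0// invr_eq0; lra.
Qed.

Lemma jt_norm_ge p x F : 1 < p -> segment_family F ->
  \sum_(S <- F) `|\sum_(t <- S) (x t : R)| `^ p <= jt_norm p x `^ p.
Proof.
move=> p1 Ff; have p0 : 0 < p by lra.
rewrite -[leLHS]powRr1; last by apply: sumr_ge0 => S _; exact: powR_ge0.
rewrite -(mulVf (lt0r_neq0 p0)) powRrM.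
apply: ge0_ler_powR; rewrite ?nnegrE ?powR_ge0 ?jt_norm_ge0 ?(ltW p0)//.
by apply: (sup_upper_bound (jt_norm_has_sup x p1)); exists F.
Qed.

Lemma jt_norm_le p x M : 1 < p -> 0 <= M ->
  (forall F, segment_family F ->
    \sum_(S <- F) `|\sum_(t <- S) (x t : R)| `^ p <= M `^ p) ->
  jt_norm p x <= M.
Proof.
move=> p1 M0 ub; have p0 : 0 < p by lra.
apply: ge_sup; first exact: (jt_norm_has_sup x p1).1.
move=> _ [F Ff <-]; rewrite -[leRHS]powRr1// -(mulfV (lt0r_neq0 p0)) powRrM.
apply: ge0_ler_powR; rewrite ?nnegrE ?powR_ge0 ?invr_ge0 ?(ltW p0) ?ub//.
by apply: sumr_ge0 => S _; exact: powR_ge0.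
Qed.

End JamesNorm.

(** * Combinatorics of segments: greatest nodes, children, fresh labels *)

Section Segments.
Implicit Types (S : {fset seq nat}) (F : seq {fset seq nat}) (s t : seq nat).

Lemma prefix_rconsE s t n : prefix t (rcons s n) = (t == rcons s n) || prefix t s.
Proof.
elim: s t => [|m s IHs] t; first by rewrite prefixs1 prefixs0 orbC.
case: t => [|k t]; first by rewrite !prefix0s orbT.
by rewrite rcons_cons !prefix_cons IHs eqseq_cons andb_orr.
Qed.

Lemma prefix_rcons_irrefl s n : prefix (rcons s n) s = false.
Proof. by apply/negP => /size_prefix; rewrite size_rcons ltnn. Qed.

Lemma prefix_size_eq s t : prefix s t -> (size t <= size s)%N -> s = t.
Proof. by rewrite prefixE => /eqP {2}<- st; rewrite take_oversize. Qed.

Lemma segment_fset1 t : segment [fset t]%fset.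
Proof.
split=> [|s s'|s s' s'']; first by apply/fset0Pn; exists t; rewrite !inE.
  by rewrite !inE => /eqP -> /eqP ->; rewrite prefix_refl.
rewrite !inE => /eqP -> /eqP -> tt' t't; apply/eqP/esym/(prefix_size_eq tt').
exact: size_prefix.
Qed.

Lemma segment_family_map (I : eqType) (r : seq I) (phi : I -> {fset seq nat}) :
  uniq r -> {in r, forall i, segment (phi i)} ->
  {in r &, forall i j t, t \in phi i -> t \in phi j -> i = j} ->
  segment_family (map phi r).
Proof.
move=> ur sr dr; split=> [S /mapP[i ir ->]|]; first exact: sr.
elim: r ur sr dr => //= i r IHr /andP[ir ur] sr dr; apply/andP; split; last first.
  apply: IHr => // [j jr|j k jr kr]; first by apply: sr; rewrite inE jr orbT.
  by apply: dr; rewrite inE ?jr ?kr orbT.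
apply/allP => _ /mapP[j jr ->]; apply/fdisjointP => t ti; apply/negP => tj.
by move: ir; rewrite (dr i j _ _ t)// ?inE ?eqxx ?jr// orbT.
Qed.

(** A segment occurring twice would be disjoint from itself, yet segments are nonempty. *)
Lemma segment_family_uniq F : segment_family F -> uniq F.
Proof.
case; elim: F => //= S F IHF sF /andP[/allP dS dF]; apply/andP; split.
  apply/negP => /dS; have [/fset0Pn[t tS] _ _] := sF S (mem_head _ _).
  by move/fdisjointP/(_ _ tS); rewrite tS.
by apply: IHF => // S' S'F; apply: sF; rewrite inE S'F orbT.
Qed.

Lemma segment_family_inj F t : segment_family F ->
  {in F &, forall S S', t \in S -> t \in S' -> S = S'}.
Proof.
case=> _; elim: F => //= S F IHF /andP[/allP dS dF] U V; rewrite !inE.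
move=> /predU1P[->|UF] /predU1P[->|VF] // tU tV; last exact: IHF.
  by have /fdisjointP/(_ _ tU) := dS _ VF; rewrite tV.
by have /fdisjointP/(_ _ tV) := dS _ UF; rewrite tU.
Qed.

Lemma segment_capr S (D : {fset seq nat}) : segment S ->
  {in D, forall t s, prefix s t -> s \in D} ->
  (S `&` D)%fset != fset0 -> segment (S `&` D)%fset.
Proof.
move=> [_ cS iS] Dp SD; split=> // [s t|s t u].
  by rewrite !inE => /andP[sS _] /andP[tS _]; exact: cS.
rewrite !inE => /andP[sS _] /andP[uS uD] st tu; rewrite (iS s t u)//=.
exact: Dp tu.
Qed.

(* Junk value, the root, when [S] has no greatest element. *)
Definition top S : seq nat :=
  xget [::] [set t | t \in S /\ {in S, forall s, prefix s t}].

Lemma topP S : segment S -> top S \in S /\ {in S, forall s, prefix s (top S)}.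
Proof.
move=> [/fset0Pn[t0 t0S] cS _].
(* A node of greatest length is the greatest node, since [S] is a chain and comparable nodes are
   ordered by length. *)
suff [t tS st] : exists2 t, t \in S & {in S, forall s, (size s <= size t)%N}.
  rewrite /top; case: xgetP => [u _ //|/(_ t)/=[]]; split=> // s sS.
  have /orP[//|ts] := cS _ _ sS tS.
  by rewrite (prefix_size_eq ts) ?prefix_refl ?st.
have exS : exists n, has (fun s => size s == n) S.
  by exists (size t0); apply/hasP; exists t0.
have ubS n : has (fun s => size s == n) S -> (n <= \max_(s <- S) size s)%N.
  by move=> /hasP[s sS /eqP <-]; exact: leq_bigmax_seq.
case: (ex_maxnP exS ubS) => _ /hasP[t tS /eqP <-] tmax; exists t => // s sS.
by apply: tmax; apply/hasP; exists s.
Qed.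

Lemma top_in S : segment S -> top S \in S. Proof. by move/topP => []. Qed.

Lemma prefix_top S s : segment S -> s \in S -> prefix s (top S).
Proof. by move/topP => [_]; apply. Qed.

Definition child n S := rcons (top S) n.

Definition extend n S := (child n S |` S)%fset.

Lemma child_notin n S : segment S -> child n S \notin S.
Proof.
by move=> sS; apply/negP => /(prefix_top sS); rewrite prefix_rcons_irrefl.
Qed.

(** Below [child n S] lie only that node itself and the prefixes of [top S], so the interval
    property is inherited from [S]. *)
Lemma segment_extend n S : segment S -> segment (extend n S).
Proof.
move=> sS; have [_ cS iS] := sS; have topS := prefix_top sS.
split=> [|s t|s t u]; first by apply/fset0Pn; exists (child n S); rewrite !inE eqxx.
- rewrite !inE => /predU1P[->|sS'] /predU1P[->|tS']; rewrite ?prefix_refl//.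
  + by rewrite [prefix t _]prefix_rconsE topS// !orbT.
  + by rewrite [prefix s _]prefix_rconsE topS// orbT.
  + exact: cS.
- rewrite !inE => /predU1P[->|sS'] /predU1P[->|uS'] st tu.
  + by rewrite (prefix_size_eq st) ?eqxx// size_prefix.
  + move: (prefix_trans st (prefix_trans tu (topS _ uS'))).
    by rewrite prefix_rcons_irrefl.
  + move: tu; rewrite prefix_rconsE => /orP[->//|tT].
    by rewrite (iS s t (top S)) ?orbT// top_in.
  + by rewrite (iS s t u) ?orbT.
Qed.

Lemma ex_fresh (r : seq (seq nat)) :
  exists N, forall n, (N <= n)%N -> {in r, forall t, n \notin t}.
Proof.
exists (\max_(m <- flatten r) m).+1 => n Nn t tr; apply/negP => nt.
have : (n <= \max_(m <- flatten r) m)%N.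
  by apply: leq_bigmax_seq => //; apply/flattenP; exists t.
by move/(leq_trans Nn); rewrite ltnn.
Qed.

(** A proper prefix of [child k V] is a prefix of [top V], and the label [n] occurs nowhere in
    [top V]. Hence the new nodes form an antichain. *)
Lemma prefix_child F (ns : seq nat) : segment_family F ->
  {in F, forall S, {in S, forall t, {in ns, forall n, n \notin t}}} ->
  {in [seq (U, n) | U <- F, n <- ns] &, forall c d,
    prefix (child c.2 c.1) (child d.2 d.1) -> c = d}.
Proof.
move=> Ff fresh _ _ /allpairsP[[U n]/= [SF nns ->]] /allpairsP[[V k]/= [S'F kns ->]].
have [sS sS'] := (Ff.1 _ SF, Ff.1 _ S'F).
rewrite prefix_rconsE => /orP[/eqP/rcons_inj[tt ->]|].
  congr (_, _); apply: (segment_family_inj Ff SF S'F (top_in sS)).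
  by rewrite tt top_in.
move/prefixP => [r Tr]; move: (fresh _ S'F _ (top_in sS') _ nns).
by rewrite Tr mem_cat mem_rcons mem_head.
Qed.

(** A new node contains the label [n], so it lies in no old segment; two new nodes coincide only if
    the tops do, and disjoint segments have different tops. *)
Lemma extend_family F n : segment_family F ->
  {in F, forall S, {in S, forall t, n \notin t}} ->
  segment_family (map (extend n) F).
Proof.
move=> Ff fresh; apply: segment_family_map; first exact: segment_family_uniq.
  by move=> S SF; apply: segment_extend; exact: Ff.1.
move=> S S' SF S'F t; have [sS sS'] := (Ff.1 _ SF, Ff.1 _ S'F).
have nc U : n \in child n U by rewrite mem_rcons mem_head.
rewrite !inE => /predU1P[->|tS] /predU1P[tS'|tS'].
- have /rcons_inj[tt] := tS'; apply: (segment_family_inj Ff SF S'F (top_in sS)).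
  by rewrite tt top_in.
- by move: (fresh _ S'F _ tS'); rewrite nc.
- by move: (fresh _ SF _ tS); rewrite tS' nc.
- exact: (segment_family_inj Ff SF S'F tS tS').
Qed.

End Segments.

(** * Restrictions and unit vectors in [c00] *)

Section FiniteSupportFunctions.
Context {T : choiceType} {R : realType}.
Implicit Types (D : {fset T}) (f : T -> R) (x : c00 T R) (t : T).

Lemma c00_restrict_subproof D f :
  (fun t => if t \in D then f t else 0 : R^o) \in @Defs.finite_support T R.
Proof.
apply/asboolP; apply: (@sub_finite_set _ _ [set` D]) => [t /=|].
  by case: ifP => //; rewrite eqxx.
exact: finite_fset.
Qed.

Definition c00_restrict D f : c00 T R := C00 (c00_restrict_subproof D f).

Definition delta t : c00 T R := c00_restrict [fset t]%fset (fun=> 1).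

Lemma c00_restrictE D f t : c00_restrict D f t = (if t \in D then f t else 0) :> R.
Proof. by []. Qed.

Lemma deltaE s t : delta s t = (t == s)%:R :> R.
Proof. by rewrite c00_restrictE inE; case: eqP. Qed.

Lemma c00_sumE (I : Type) (r : seq I) (F : I -> c00 T R) t :
  (\sum_(i <- r) F i) t = \sum_(i <- r) (F i t : R) :> R.
Proof. exact: (big_morph (fun x : c00 T R => x t : R)). Qed.

End FiniteSupportFunctions.

(** * Norm estimates on antichains and on prefix-closed sets *)

Section JamesNormEstimates.
Context {R : realType}.
Implicit Types (p : R) (x : c00 (seq nat) R) (F : seq {fset seq nat}).

Lemma sum_delta (I : Type) (r : seq I) (b : I -> R) (tau : I -> seq nat)
    (S : {fset seq nat}) :
  \sum_(t <- S) ((\sum_(i <- r) b i *: delta (tau i) : c00 (seq nat) R) t : R) =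
  \sum_(i <- r) b i * (tau i \in S)%:R.
Proof.
under eq_bigr => t _ do rewrite c00_sumE.
rewrite exchange_big /=; apply: eq_bigr => i _.
rewrite (eq_bigr (fun t => b i * (t == tau i)%:R)); last first.
  by move=> t _; rewrite -deltaE.
rewrite -mulr_sumr; congr (_ * _).
case: (boolP (tau i \in S)) => iS.
  rewrite (bigD1_seq (tau i)) ?fset_uniq //= eqxx big1 ?addr0// => t /negPf -> //.
by rewrite big1_seq// => t /= tS; case: eqP tS iS => // -> ->.
Qed.

(** At most one index satisfies [P], so at most one term on the left is nonzero. *)
Lemma powR_sum_indicator_le (I : eqType) (r : seq I) (b : I -> R) (P : pred I) p :
  0 < p -> uniq r -> {in r &, forall i j, P i -> P j -> i = j} ->
  `|\sum_(i <- r) b i * (P i)%:R| `^ p <= \sum_(i <- r) `|b i| `^ p * (P i)%:R.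
Proof.
move=> p0 ur Pr; case: (boolP (has P r)) => [/hasP[i ir Pi]|/hasPn nP].
  have Pj j : j \in r -> j != i -> P j = false.
    by move=> jr; apply: contraNF => Pj; rewrite (Pr j i).
  rewrite (bigD1_seq i) //= Pi mulr1 big1_seq ?addr0; last first.
    by move=> j /andP[ji /Pj ->//]; rewrite mulr0.
  rewrite [leRHS](bigD1_seq i) //= Pi mulr1 lerDl.
  by apply: sumr_ge0 => j _; rewrite mulr_ge0 ?powR_ge0.
rewrite big1_seq ?normr0 ?powR0 ?lt0r_neq0//; last first.
  by move=> i /nP/negPf ->; rewrite mulr0.
by apply: sumr_ge0 => j _; rewrite mulr_ge0 ?powR_ge0.
Qed.

(** A chain meets an antichain in at most one node, so each segment picks up at most one
    coefficient, and disjoint segments pick up different ones. *)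
Lemma jt_norm_antichain (I : eqType) (r : seq I) (b : I -> R)
    (tau : I -> seq nat) p M : 1 < p -> 0 <= M -> uniq r ->
  {in r &, forall i j, prefix (tau i) (tau j) -> i = j} ->
  \sum_(i <- r) `|b i| `^ p <= M `^ p ->
  jt_norm p (\sum_(i <- r) b i *: delta (tau i) : c00 (seq nat) R) <= M.
Proof.
move=> p1 M0 ur ar bM; have p0 : 0 < p by lra.
apply: jt_norm_le => // F Ff; apply: le_trans bM.
apply: (@le_trans _ _
    (\sum_(S <- F) \sum_(i <- r) `|b i| `^ p * (tau i \in S)%:R)).
  rewrite big_seq [leRHS]big_seq; apply: ler_sum => S SF; rewrite sum_delta.
  apply: (@powR_sum_indicator_le _ r b (fun i => tau i \in S)) => // i j ir jr iS jS.
  have [_ cS _] := Ff.1 _ SF.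
  by have /orP[|] := cS _ _ iS jS; [apply: ar|move/ar/esym; apply].
rewrite exchange_big; apply: ler_sum => i _.
rewrite -mulr_sumr -[leRHS]mulr1 ler_wpM2l ?powR_ge0//.
exact: segment_family_sum_mem.
Qed.

Lemma coord_le_jt_norm p x (t : seq nat) : 1 < p -> `|x t : R| <= jt_norm p x.
Proof.
move=> p1; have p0 : 0 < p by lra.
have /(jt_norm_ge x p1) : segment_family [:: [fset t]%fset].
  by split=> // S; rewrite inE => /eqP ->; exact: segment_fset1.
rewrite big_seq1 big_seq_fset1 => xt; rewrite -[leLHS]powRr1//.
rewrite -(mulfV (lt0r_neq0 p0)) powRrM -[leRHS]powRr1 ?jt_norm_ge0//.
rewrite -(mulfV (lt0r_neq0 p0)) powRrM.
by apply: ge0_ler_powR; rewrite ?nnegrE ?powR_ge0 ?invr_ge0 ?(ltW p0).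
Qed.

(** Cutting segments down to a prefix-closed set gives segments again. Family sums of a restriction
    are thus family sums of [f] itself, which may have infinite support. *)
Lemma segment_family_restrict p F (D : {fset seq nat}) (f : seq nat -> R) :
  0 < p -> segment_family F -> {in D, forall t s, prefix s t -> s \in D} ->
  exists2 G, segment_family G &
    \sum_(S <- F) `|\sum_(t <- S) (c00_restrict D f t : R)| `^ p =
    \sum_(S <- G) `|\sum_(t <- S) f t| `^ p.
Proof.
move=> p0 Ff Dp; pose G := [seq U <- F | (U `&` D)%fset != fset0].
(* Empty intersections are not segments and must be dropped; they contribute zero to the sum. *)
exists [seq (U `&` D)%fset | U <- G].
  apply: segment_family_map; first by rewrite filter_uniq ?segment_family_uniq.
    move=> S; rewrite mem_filter => /andP[S0 SF]; apply: segment_capr => //.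
    exact: Ff.1.
  move=> S S'; rewrite !mem_filter => /andP[_ SF] /andP[_ S'F] t.
  by rewrite !inE => /andP[tS _] /andP[tS' _]; exact: (segment_family_inj Ff SF S'F tS tS').
have eqS (S : {fset seq nat}) :
    \sum_(t <- S) (c00_restrict D f t : R) = \sum_(t <- (S `&` D)%fset) f t.
  rewrite (eq_bigr _ (fun t _ => c00_restrictE D f t)) -big_mkcond /= -big_filter.
  apply/perm_big/uniq_perm; rewrite ?filter_uniq ?fset_uniq// => t.
  by rewrite mem_filter !inE andbC.
rewrite big_map big_filter [LHS](bigID (fun U => (U `&` D)%fset != fset0)) /=.
rewrite [X in _ + X]big1 ?addr0; first by apply: eq_bigr => S _; rewrite eqS.
by move=> S; rewrite negbK eqS => /eqP ->; rewrite big_seq_fset0 normr0 powR0 ?gt_eqF.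
Qed.

End JamesNormEstimates.

(** * Bounded functionals and the dual norm *)

Section DualNorm.
Context {R : realType} (V : normedModType R).
Implicit Types (f g : dual V) (x : V) (A : set V).

Lemma dualP (a : R) f g x : (a *: f + g) x = a * f x + g x :> R.
Proof. by []. Qed.

Lemma dual_norm_apply f x : `|f x : R| <= `|f| * `|x|.
Proof.
have [->|x0] := eqVneq x 0; first by rewrite linear0 !normr0 mulr0.
have nx : 0 < `|x| by rewrite normr_gt0.
rewrite -ler_pdivrMr// mulrC -[X in X * _]gtr0_norm ?invr_gt0// -normrM.
rewrite [X in `|X|](_ : _ = f (`|x|^-1 *: x)); last by rewrite linearZ.
by apply: dual_norm_ub; rewrite normrZ normfV normr_id mulVf// gt_eqF.
Qed.

Lemma dual_of_bounded (h : V -> R^o) (C : R) : linear h ->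
  (forall x, `|h x : R| <= C * `|x|) -> exists f : dual V, forall x, f x = h x.
Proof.
move=> hl hC.
pose H : {linear V -> R^o} := HB.pack h (GRing.isLinear.Build R V R^o _ h hl).
have hc : continuous (h : V -> R).
  apply: (@bounded_linear_continuous R V R^o H); apply/bounded_funP => r.
  exists (`|C| * r) => x xr; apply: le_trans (hC x) _.
  by apply: le_trans (ler_wpM2r _ (ler_norm C)) _ => //; exact: ler_wpM2l.
have hm : h \in @continuous_functional R V by apply/asboolP; exact: (conj hl hc).
by exists (Dual hm).
Qed.

Lemma cspan_valP A (a : R) (b c : cspan A) :
  cspan_val (a *: b + c) = a *: cspan_val b + cspan_val c.
Proof. by []. Qed.

End DualNorm.

(** * Functionals determined on a dense subspace *)

Section DenseRange.
Context {R : realType} (X : completeNormedModType R) (E : lmodType R)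
  (J : {linear E -> X}).
Hypothesis J_dense : closure (range J) = setT.

Lemma dense_range (x : X) (e : R) : 0 < e -> exists u, `|x - J u| < e.
Proof.
move=> e0; have : closure (range J) x by rewrite J_dense.
move/(_ (ball x e) (nbhsx_ballx x e e0)) => [_ [[u _ <-]]].
by rewrite -ball_normE => xu; exists u.
Qed.

(** Scaling [u] by plus or minus the inverse of its norm turns the one-sided bound into
    [|g (J u)| <= C * |J u|]; continuity carries this to all of [X]. *)
Lemma dual_norm_le_dense (g : dual X) (C : R) : 0 <= C ->
  (forall u, `|J u| <= 1 -> (g (J u) : R) <= C) -> `|g| <= C.
Proof.
move=> C0 gC.
have gCu u : `|g (J u) : R| <= C * `|J u|.
  have [Ju0|Ju0] := eqVneq (J u) 0; first by rewrite Ju0 linear0 !normr0 mulr0.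
  have nJu : 0 < `|J u| by rewrite normr_gt0.
  have bnd k : `|k| = `|J u|^-1 -> k * (g (J u) : R) <= C.
    move=> kE; rewrite [leLHS](_ : _ = g (J (k *: u))); last by rewrite !linearZ.
    by apply: gC; rewrite linearZ normrZ kE mulVf// gt_eqF.
  rewrite -ler_pdivrMr// mulrC -[X in X * _]gtr0_norm ?invr_gt0// -normrM ler_norml.
  rewrite bnd ?normfV ?normr_id// andbT -lerN2 opprK -mulNr.
  by rewrite bnd// normrN normfV normr_id.
apply: dual_norm_lub => x x1; apply/ler_addgt0Pr => e e0.
have gc : `|g y : R| @[y --> x] --> `|g x : R|.
  by apply: cvg_norm; exact: dual_continuous.
(* Chosen so that [C * d + d = e / 2]: approximating [x] within [d] costs at most [C * d], and
   continuity of [g] costs the other [e / 2]. *)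
pose d := e / (2 * (C + 1)).
have d0 : 0 < d by rewrite divr_gt0// mulr_gt0//; lra.
have /cvgrPdist_le/(_ (e / 2)) := gc; rewrite divr_gt0// => /(_ isT).
move=> /nbhs_ballP[r /= r0 rP].
have [|u] := @dense_range x (Num.min r d); first by rewrite lt_min r0 d0.
rewrite lt_min => /andP[xur xud].
have := rP (J u); rewrite -ball_normE => /(_ xur) /= /ler_normlW gxu.
have : `|J u| <= 1 + d.
  rewrite -[J u](subrK x); apply: le_trans (ler_normD _ _) _.
  by rewrite addrC lerD// distrC ltW.
move=> Jud; have := gCu u.
have CJ : C * `|J u| <= C * (1 + d) by rewrite ler_wpM2l.
have Cd : C * d + d = e / 2 by rewrite /d; field; lra.
lra.
Qed.

(** The extension is the McShane formula [g x = sup_u (phi u - |J u - x|)]. The single estimate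
    [|g x - phi u| <= |J u - x|] gives agreement with [phi], linearity by density, and, at [u = 0],
    boundedness. *)
Lemma dual_extension (phi : {linear E -> R^o}) :
  (forall u, `|phi u : R| <= `|J u|) ->
  exists g : dual X, forall u, g (J u) = phi u.
Proof.
move=> phiJ.
pose A x := [set (phi u : R) - `|J u - x| | u in [set: E]].
have AB x u v : (phi u : R) - `|J u - x| <= (phi v : R) + `|J v - x|.
  rewrite lerBlDr -addrA -lerBlDl; have -> : (phi u : R) - phi v = phi (u - v).
    by rewrite linearB.
  apply: le_trans (ler_norm _) _; apply: le_trans (phiJ _) _.
  rewrite linearB -[J u - J v](subrKA x) [leRHS]addrC (distrC (J v)).
  exact: ler_normD.
have Asup x : has_sup (A x).
  split; first by exists ((phi 0 : R) - `|J 0 - x|), 0.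
  by exists ((phi 0 : R) + `|J 0 - x|) => _ [u _ <-]; exact: AB.
pose g x : R^o := sup (A x).
have gP x u : `|(g x : R) - phi u| <= `|J u - x|.
  rewrite ler_norml; apply/andP; split.
    rewrite lerBrDl; apply: (sup_upper_bound (Asup x)).
    by exists u.
  rewrite lerBlDl; apply: ge_sup; first exact: (Asup x).1.
  by move=> _ [v _ <-]; exact: AB.
have gJ u : g (J u) = phi u.
  by apply/eqP; rewrite -subr_eq0 -normr_le0; apply: le_trans (gP _ u) _; rewrite subrr normr0.
have gl : linear g.
  move=> a x y; apply/eqP; rewrite -subr_eq0 -normr_le0; apply/ler_addgt0Pr => e e0.
  rewrite add0r.
  (* The approximation error [(|a| + 1) * d = e / 2] occurs twice: for [g (a *: x + y)] and for
     [a *: g x + g y]. *)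
  pose d := e / (2 * (`|a| + 1)).
  have a0 : 0 < `|a| + 1 by rewrite ltr_wpDl.
  have d0 : 0 < d by rewrite divr_gt0// mulr_gt0.
  have [u xu] := dense_range x d0.
  have [v yv] := dense_range y d0.
  rewrite distrC in xu; rewrite distrC in yv.
  have g1 := gP x u; have g2 := gP y v; have g3 := gP (a *: x + y) (a *: u + v).
  have J3 : `|J (a *: u + v) - (a *: x + y)| <= `|a| * `|J u - x| + `|J v - y|.
    rewrite linearP opprD addrACA -scalerBr -normrZ; exact: ler_normD.
  have p3 : phi (a *: u + v) = a * phi u + phi v :> R by rewrite linearP.
  rewrite p3 in g3.
  have -> : g (a *: x + y) - (a *: g x + g y) =
    ((g (a *: x + y) : R) - (a * phi u + phi v)) - (a * (g x - phi u) + (g y - phi v)).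
    rewrite [a *: g x](_ : _ = a * g x)//; lra.
  apply: le_trans (ler_normB _ _) _.
  have g4 : `|a * ((g x : R) - phi u) + ((g y : R) - phi v)| <= `|a| * `|J u - x| + `|J v - y|.
    by apply: le_trans (ler_normD _ _) _; rewrite normrM lerD// ler_wpM2l.
  have a1 : `|a| * `|J u - x| <= `|a| * d by rewrite ler_wpM2l// ltW.
  have ad : (`|a| + 1) * d = e / 2 by rewrite /d; field; lra.
  lra.
have [|h hE] := dual_of_bounded gl (C := 1).
  by move=> x; have := gP x 0; rewrite (linear0 phi) (linear0 J) sub0r normrN subr0 mul1r.
by exists h => u; rewrite hE gJ.
Qed.

End DenseRange.

(** * Coordinate functionals on the completion and their closed span *)

Section CoordinateSpan.
Context {R : realType} (p : R) (X : completeNormedModType R)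
  (J : {linear c00 (seq nat) R -> X}).
Hypotheses (p1 : 1 < p) (hJ : is_JT p J).
Implicit Types (b : B_infty J) (u v : c00 (seq nat) R).

Definition pairing b u : R := (cspan_val b : dual X) (J u).

Lemma pairing_linearl (a : R) b c u :
  pairing (a *: b + c) u = a * pairing b u + pairing c u.
Proof. by rewrite /pairing cspan_valP dualP. Qed.

Lemma pairing_linearr (a : R) b u v :
  pairing b (a *: u + v) = a * pairing b u + pairing b v.
Proof. by rewrite /pairing linearP linearP. Qed.

Lemma pairing_le b u : `|pairing b u| <= `|b| * jt_norm p u.
Proof. by rewrite -hJ.1; exact: dual_norm_apply. Qed.

Lemma norm_le_pairing b C : 0 <= C ->
  (forall u, jt_norm p u <= 1 -> pairing b u <= C) -> `|b| <= C.
Proof.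
move=> C0 bC; apply: (dual_norm_le_dense hJ.2 C0) => u.
by rewrite hJ.1; exact: bC.
Qed.

(** Evaluation at [t] is defined on [c00] only; it is dominated by the James norm, hence extends to
    the completion. *)
Lemma exists_coordinates : exists e : seq nat -> B_infty J,
  forall t u, pairing (e t) u = u t.
Proof.
suff /choice[e eE] : forall t, exists b, forall u, pairing b u = u t by exists e.
move=> t.
pose phi (u : c00 (seq nat) R) : R^o := u t.
have phil : linear phi by [].
pose Phi : {linear c00 (seq nat) R -> R^o} :=
  HB.pack phi (GRing.isLinear.Build R (c00 (seq nat) R) R^o _ phi phil).
have [u|g gJ] := @dual_extension _ _ _ _ hJ.2 Phi.
  by rewrite hJ.1; exact: coord_le_jt_norm.
have gB : g \in closed_span (coord_functionals J).
  apply/asboolP/subset_closure; exists [:: (1, g)].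
    by move=> c; rewrite inE => /eqP -> /=; exists t.
  by rewrite big_seq1 scale1r.
by exists (CSpan gB) => u; exact: gJ.
Qed.

Lemma coordinates_dense (e : seq nat -> B_infty J) (z : B_infty J) (d : R) :
  (forall t u, pairing (e t) u = u t) -> 0 < d ->
  exists s : seq (R * seq nat), `|z - \sum_(c <- s) c.1 *: e c.2| < d.
Proof.
move=> eE d0; have /asboolP zc : cspan_val z \in closed_span (coord_functionals J).
  by case: z.
have [_ [[s sA ->]]] := zc _ (nbhsx_ballx (cspan_val z) d d0).
rewrite -ball_normE /= => zs.
(* Selects a node for each generator; the default root is never reached, as all generators in [s]
   are coordinate functionals. *)
pose tau (g : dual X) := xget [::] [set t | forall x, g (J x) = x t].
exists [seq (c.1, tau c.2) | c <- s]; rewrite big_map.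
suff sE : \sum_(c <- s) c.1 *: c.2 = cspan_val (\sum_(c <- s) c.1 *: e (tau c.2)).
  by rewrite sE in zs.
elim: s sA {zs} => [|c s IHs] sA; first by rewrite !big_nil.
rewrite !big_cons IHs; last by move=> d' ds; apply: sA; rewrite inE ds orbT.
rewrite [RHS]cspan_valP; congr (_ *: _ + _).
apply/eqP; rewrite -subr_eq0 -normr_le0; apply: (dual_norm_le_dense hJ.2) => // u _.
have [t0 ht0] := sA _ (mem_head c s).
have ht : forall x, c.2 (J x) = x (tau c.2).
  by rewrite /tau; case: xgetP => [t _ h|/(_ t0) h]; [exact: h|case: h].
by rewrite addrC -scaleN1r dualP ht -[X in _ * X]/(pairing (e (tau c.2)) u) eE mulN1r addNr.
Qed.

End CoordinateSpan.

(** * Conjugate exponents and the equality case of Hoelder's inequality *)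

Section ConjugateExponents.
Context {R : realType} (p q : R).
Hypotheses (p1 : 1 < p) (hpq : p^-1 + q^-1 = 1).

Lemma conjugate_gt1 : 1 < q.
Proof.
have p0 : 0 < p by exact: lt_trans p1.
have pV1 : p^-1 < 1 by rewrite invf_lt1.
have pV0 : 0 < p^-1 by rewrite invr_gt0.
have qV0 : 0 < q^-1 by move: hpq; lra.
have q0 : 0 < q by rewrite -invr_gt0.
by rewrite -invf_lt1//; move: hpq; lra.
Qed.

Lemma conjugate_mul : (p - 1) * q = p.
Proof.
have q0 : q != 0 by rewrite gt_eqF// (lt_trans _ conjugate_gt1).
have p0 : p != 0 by rewrite gt_eqF// (lt_trans _ p1).
apply: (mulIf (invr_neq0 q0)); rewrite mulfK//.
have -> : q^-1 = 1 - p^-1 by move: hpq; lra.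
by rewrite mulrBr mulr1 mulfV.
Qed.

(** Here [b] is [y] normalised in l_p and [a = sg(b) |b|^(p-1)] its norming sequence in l_q, by
    [(p - 1) * q = p]. Then [sum a y] is the l_p norm of [y]. *)
Lemma dual_weights (I : Type) (r : seq I) (y : I -> R) (M : R) :
  0 <= M -> M `^ p < \sum_(i <- r) `|y i| `^ p ->
  exists a b : I -> R, [/\ \sum_(i <- r) `|a i| `^ q = 1,
    \sum_(i <- r) `|b i| `^ p = 1, \sum_(i <- r) a i * b i = 1 &
    M < \sum_(i <- r) a i * y i].
Proof.
move=> M0; have p0 : 0 < p by exact: lt_trans p1.
set s := \sum_(i <- r) _ => Ms.
have s0 : 0 < s by apply: le_lt_trans Ms; exact: powR_ge0.
pose N := s `^ p^-1.
have N0 : 0 < N by exact: powR_gt0.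
have NE : N `^ p = s by rewrite /N -powRrM mulVf ?gt_eqF// powRr1// ltW.
have MN : M < N.
  rewrite ltNge; apply/negP => NM; move: Ms; rewrite ltNge -NE => /negP; apply.
  by apply: ge0_ler_powR; rewrite ?nnegrE ?(ltW p0) ?(ltW N0).
pose b i := y i / N; pose a i := Num.sg (b i) * `|b i| `^ (p - 1).
have ab i : a i * b i = `|b i| `^ p.
  by rewrite /a mulrAC -normrEsg mulr_powRB1.
have aq i : `|a i| `^ q = `|b i| `^ p.
  rewrite /a; have [->|b0] := eqVneq (b i) 0.
    rewrite sgr0 mul0r normr0 !powR0// gt_eqF//.
    by rewrite (lt_trans _ conjugate_gt1).
  by rewrite normrM normr_sg b0 mul1r ger0_norm ?powR_ge0// -powRrM conjugate_mul.
have yb i : y i = b i * N by rewrite /b divfK// gt_eqF.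
have b1 : \sum_(i <- r) `|b i| `^ p = 1.
  apply: (mulIf (lt0r_neq0 s0)); rewrite mul1r mulr_suml; apply: eq_bigr => i _.
  by rewrite -NE [in RHS]yb (normrM (b i) N) (gtr0_norm N0) powRM// ltW.
exists a, b; split=> //; first by under eq_bigr do rewrite aq.
  by under eq_bigr do rewrite ab.
under eq_bigr => i _ do rewrite yb mulrA ab.
by rewrite -mulr_suml b1 mul1r.
Qed.

End ConjugateExponents.

(* An abstraction of [B_infty], with [pr b u] the value at [J u] of the functional [b]
   and [e t] the functional [e_t^*]. *)
Record coordinate_duality {R : realType} (p : R) (B : normedModType R)
    (pr : B -> c00 (seq nat) R -> R) (e : seq nat -> B) : Prop := {
  pr_linearl : forall a b c u, pr (a *: b + c) u = a * pr b u + pr c u;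
  pr_linearr : forall a b u v, pr b (a *: u + v) = a * pr b u + pr b v;
  pr_le : forall b u, `|pr b u| <= `|b| * jt_norm p u;
  norm_le_pr : forall b C, 0 <= C ->
    (forall u, jt_norm p u <= 1 -> pr b u <= C) -> `|b| <= C;
  pr_coord : forall t u, pr (e t) u = u t;
  coord_dense : forall z d, 0 < d ->
    exists s : seq (R * seq nat), `|z - \sum_(c <- s) c.1 *: e c.2| < d }.

(** * Molecules in the unit ball, and families that nearly norm a functional *)

Section Duality.
Context {R : realType} (p q : R) (B : normedModType R)
  (pr : B -> c00 (seq nat) R -> R) (e : seq nat -> B).
Hypotheses (p1 : 1 < p) (hpq : p^-1 + q^-1 = 1)
  (dB : coordinate_duality p pr e).
Implicit Types (u v : c00 (seq nat) R) (f : dual B) (F : seq {fset seq nat}).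

Lemma pr_suml (I : Type) (r : seq I) (a : I -> R) (b : I -> B) u :
  pr (\sum_(i <- r) a i *: b i) u = \sum_(i <- r) a i * pr (b i) u.
Proof.
elim: r => [|i r IHr]; last by rewrite !big_cons (pr_linearl dB) IHr.
rewrite !big_nil; have := pr_linearl dB (-1) 0 0 u.
by rewrite scaler0 addr0 mulN1r addNr.
Qed.

Lemma pr_sumr (I : Type) (r : seq I) (a : I -> R) b (u : I -> c00 (seq nat) R) :
  pr b (\sum_(i <- r) a i *: u i) = \sum_(i <- r) a i * pr b (u i).
Proof.
elim: r => [|i r IHr]; last by rewrite !big_cons (pr_linearr dB) IHr.
rewrite !big_nil; have := pr_linearr dB (-1) b 0 0.
by rewrite scaler0 addr0 mulN1r addNr.
Qed.

Lemma prBl b c u : pr (b - c) u = pr b u - pr c u.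
Proof. by rewrite addrC -scaleN1r (pr_linearl dB) mulN1r addrC. Qed.

Lemma dual_sum f (I : Type) (r : seq I) (a : I -> R) (b : I -> B) :
  f (\sum_(i <- r) a i *: b i) = \sum_(i <- r) a i * f (b i) :> R.
Proof. by rewrite linear_sum; apply: eq_bigr => i _; rewrite linearZ. Qed.

(* Young's inequality replaces Hoelder's, as both families of powers sum to at most one. *)
Lemma norm_molecule_le1 (I : Type) (r : seq I) (a : I -> R)
    (phi : I -> {fset seq nat}) (b : B) :
  segment_family (map phi r) -> \sum_(i <- r) `|a i| `^ q <= 1 ->
  (forall u, pr b u = \sum_(i <- r) a i * \sum_(t <- phi i) (u t : R)) ->
  `|b| <= 1.
Proof.
move=> Ff a1 bE; have p0 : 0 < p by exact: lt_trans p1.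
have q0 : 0 < q by apply: lt_trans (conjugate_gt1 p1 hpq).
apply: (norm_le_pr dB) => // u u1; rewrite bE.
have := jt_norm_ge u p1 Ff; rewrite big_map => sb.
have {sb} sb : \sum_(i <- r) `|\sum_(t <- phi i) (u t : R)| `^ p <= 1.
  apply: le_trans sb _; have <- : 1 `^ p = 1 :> R by rewrite powR1.
  by apply: ge0_ler_powR; rewrite ?nnegrE ?jt_norm_ge0 ?(ltW p0)//.
apply: (@le_trans _ _ (\sum_(i <- r)
    (`|\sum_(t <- phi i) (u t : R)| `^ p / p + `|a i| `^ q / q))).
  apply: ler_sum => i _; apply: le_trans (ler_norm _) _.
  by rewrite normrM mulrC; apply: conjugate_powR.
rewrite big_split -!mulr_suml -hpq; apply: lerD.
  by rewrite -[leRHS]mul1r ler_wpM2r// invr_ge0 ltW.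
by rewrite -[leRHS]mul1r ler_wpM2r// invr_ge0 ltW.
Qed.

Lemma norm_coordinate t : `|e t| <= 1.
Proof.
apply: (@norm_molecule_le1 unit [:: tt] (fun=> 1) (fun=> [fset t]%fset)).
- by split=> // S; rewrite inE => /eqP ->; exact: segment_fset1.
- by rewrite big_seq1 normr1 powR1.
- by move=> u; rewrite big_seq1 big_seq_fset1 mul1r (pr_coord dB).
Qed.

(** Take a finite combination [z] of coordinates with [f z] nearly 1. If all family sums were at
    most [M^p], the restriction [P] of [t |-> f (e t)] to the prefixes of the nodes of [z] would
    have norm at most [M], while [f z = pr z P]. *)
Lemma norm_attained_family f (M : R) : `|f| = 1 -> 0 <= M < 1 ->
  exists2 F, segment_family F &
    M `^ p < \sum_(S <- F) `|\sum_(t <- S) (f (e t) : R)| `^ p.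
Proof.
(* With [1 - M = 4 d], the bound [(1 + d) * M <= M + d = 1 - 3 d] contradicts [f z > 1 - 2 d]. *)
move=> f1 /andP[M0 M1]; pose d := (1 - M) / 4.
have d0 : 0 < d by rewrite /d; lra.
have p0 : 0 < p by exact: lt_trans p1.
have [b b1 fb] : exists2 b, `|b| <= 1 & 1 - d < f b.
  have [_ [b b1 <-] fb] := sup_adherent d0 (dual_norm_has_sup f).
  have {}fb : 1 - d < `|f b : R| by rewrite -f1.
  have [fb0|fb0] := leP 0 (f b : R); first by exists b => //; rewrite -(ger0_norm fb0).
  by exists (- b); rewrite ?normrN// linearN -(ltr0_norm fb0).
have [s] := coord_dense dB b d0; set z := \sum_(c <- s) _ => bz.
have fz : 1 - 2 * d < f z.
  have := dual_norm_apply f (b - z); rewrite f1 mul1r linearB => /ler_normlW /=.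
  by move=> h; have {}h : (f b : R) - f z <= `|b - z| := h; lra.
have z1 : `|z| <= 1 + d.
  by have := ler_normB b (b - z); rewrite subKr; lra.
pose D := seq_fset tt (flatten [seq [seq take i c.2 | i <- iota 0 (size c.2).+1] | c <- s]).
have Dp : {in D, forall t s, prefix s t -> s \in D}.
  move=> t; rewrite seq_fsetE => /flattenP[_ /mapP[c cs ->]] /mapP[i _ ->] t' t'i.
  rewrite seq_fsetE; apply/flattenP; eexists; first by apply/mapP; exists c.
  have := prefix_trans t'i (prefix_take _ _); rewrite prefixE => /eqP tE.
  apply/mapP; exists (size t') => //; rewrite mem_iota /= add0n ltnS.
  by rewrite -tE size_take; case: ltnP => // /ltnW.
have Ds c : c \in s -> c.2 \in D.
  move=> cs; rewrite seq_fsetE; apply/flattenP; eexists; first by apply/mapP; exists c.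
  by apply/mapP; exists (size c.2); rewrite ?take_size// mem_iota /= add0n ltnS.
pose P := c00_restrict D (fun t => f (e t)).
have fzP : f z = pr z P :> R.
  rewrite dual_sum pr_suml big_seq [RHS]big_seq; apply: eq_bigr => c cs.
  by rewrite (pr_coord dB) c00_restrictE Ds.
apply: contrapT => noF.
have PM : jt_norm p P <= M.
  apply: jt_norm_le => // F Ff.
  have [G Gf ->] := segment_family_restrict (fun t => f (e t) : R) p0 Ff Dp.
  by rewrite leNgt; apply/negP => h; apply: noF; exists G.
have h1 := pr_le dB z P.
have h2 : `|z| * jt_norm p P <= (1 + d) * M by rewrite ler_pM ?jt_norm_ge0.
have h3 := ler_norm (pr z P).
rewrite fzP in fz; have dE : d * 4 = 1 - M by rewrite /d; field.
have : d * M <= d by rewrite ler_piMr// ltW.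
lra.
Qed.

End Duality.

(** * Lower bounds: molecules extended by fresh children *)

Section BigSlices.
Context {R : realType} (p q : R) (B : normedModType R)
  (pr : B -> c00 (seq nat) R -> R) (e : seq nat -> B).
Hypotheses (p1 : 1 < p) (hpq : p^-1 + q^-1 = 1)
  (dB : coordinate_duality p pr e).
Implicit Types (u v : c00 (seq nat) R) (f : dual B) (F : seq {fset seq nat})
  (a b : {fset seq nat} -> R).

(** The label occurs at no position of any node of [F], not merely as a last entry; this is what
    makes the new nodes incomparable. *)
Definition fresh F n := forall S t, S \in F -> t \in S -> n \notin t.

Lemma exists_fresh F : exists N, forall n, (N <= n)%N -> fresh F n.
Proof.
elim: F => [|U F [N HN]]; first by exists 0%N.
have [K HK] := ex_fresh U; exists (maxn N K) => n; rewrite geq_max => /andP[Nn Kn].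
move=> S t; rewrite inE => /predU1P[->|SF]; first exact: HK.
exact: HN SF.
Qed.

(** In the notation of the overview [extended a F n] is m_n, [spread a F n] is its part on the new
    nodes, and [bump b F n] is u_n. *)
Definition spread a F n : B := \sum_(S <- F) a S *: e (child n S).

Definition extended a F n : B :=
  \sum_(S <- F) a S *: \sum_(t <- extend n S) e t.

Definition bump b F n : c00 (seq nat) R :=
  \sum_(S <- F) b S *: delta (child n S).

Lemma pr_extended a F n u : pr (extended a F n) u =
  \sum_(S <- F) a S * \sum_(t <- extend n S) (u t : R).
Proof.
rewrite (pr_suml dB); apply: eq_bigr => S _; congr (_ * _).
rewrite (eq_bigr (fun t => 1 *: e t)); last by move=> t _; rewrite scale1r.
by rewrite (pr_suml dB); apply: eq_bigr => t _; rewrite mul1r (pr_coord dB).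
Qed.

Lemma norm_extended_le1 a F n : segment_family F -> fresh F n ->
  \sum_(S <- F) `|a S| `^ q <= 1 -> `|extended a F n| <= 1.
Proof.
move=> Ff Fn a1; apply: (norm_molecule_le1 p1 hpq dB _ a1) => [|u].
  by apply: extend_family => // S SF t tS; exact: Fn tS.
exact: pr_extended.
Qed.

Lemma dual_extended f a F n : segment_family F ->
  f (extended a F n) =
  \sum_(S <- F) a S * (\sum_(t <- S) (f (e t) : R)) + f (spread a F n) :> R.
Proof.
move=> Ff; rewrite !dual_sum -big_split /= big_seq [RHS]big_seq.
apply: eq_bigr => S SF; rewrite -mulrDr; congr (_ * _).
rewrite big_fsetU1 ?child_notin//=; last exact: Ff.1.
by rewrite linearD linear_sum /= addrC.
Qed.

(** The node [child k U] avoids the old segments because [k] is fresh, and equals [child n S] only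
    when [k = n] and [U = S]. *)
Lemma pr_extended_bump a b F n k : segment_family F -> fresh F k ->
  pr (extended a F n) (bump b F k) = (k == n)%:R * \sum_(S <- F) a S * b S.
Proof.
move=> Ff Fk; rewrite pr_extended mulr_sumr big_seq [RHS]big_seq.
apply: eq_bigr => S SF; rewrite mulrCA; congr (_ * _).
rewrite sum_delta (eq_big_seq (fun U => (k == n)%:R * b U * (U == S)%:R)).
  rewrite (bigD1_seq S) ?segment_family_uniq//= eqxx mulr1 big1 ?addr0// => U.
  by move=> /negPf ->; rewrite mulr0.
move=> U UF; rewrite -mulrA mulrCA; congr (_ * _).
have kU : k \in child k U by rewrite mem_rcons mem_head.
rewrite -natrM mulnb; congr (nat_of_bool _)%:R.
rewrite !inE; have -> : (child k U \in S) = false.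
  by apply/negP => kS; move: (Fk _ _ SF kS); rewrite kU.
rewrite orbF eqseq_rcons andbC; have [_|//] := eqVneq k n.
apply/eqP/eqP => [UT|->//]; apply: (segment_family_inj Ff UF SF (t := top U)).
  by apply: top_in; exact: Ff.1.
by rewrite UT; apply: top_in; exact: Ff.1.
Qed.

(** All the children involved form an antichain, where the l_p norm governs; the l_p sum of the
    products [g n * b S] factors. *)
Lemma jt_norm_bumps b F (ns : seq nat) (g : nat -> R) (M : R) :
  segment_family F -> {in ns, forall n, fresh F n} -> uniq ns ->
  \sum_(S <- F) `|b S| `^ p = 1 -> 0 <= M ->
  \sum_(n <- ns) `|g n| `^ p <= M `^ p ->
  jt_norm p (\sum_(n <- ns) g n *: bump b F n) <= M.
Proof.
move=> Ff Fns uns b1 M0 gM.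
pose r := [seq (U, n) | U <- F, n <- ns].
rewrite [X in jt_norm p X](_ : _ =
    \sum_(c <- r) (g c.2 * b c.1) *: delta (child c.2 c.1)); last first.
  rewrite big_allpairs exchange_big; apply: eq_bigr => n _ /=.
  by rewrite scaler_sumr; apply: eq_bigr => S _; rewrite scalerA.
apply: jt_norm_antichain => //.
- by apply: allpairs_uniq => //; [exact: segment_family_uniq|case=> ? ? []].
- by apply: prefix_child => // S SF t tS n /Fns; apply; eassumption.
rewrite big_allpairs /= exchange_big /=; apply: le_trans gM.
apply: ler_sum => n _; rewrite -[leRHS]mulr1 -b1 mulr_sumr.
by apply: ler_sum => S _; rewrite normrM powRM.
Qed.

(** The singletons of the children are disjoint segments, and each weight [k * a S] is repeated
    [size ns] times, so the normalisation of [k] makes the q-th powers sum to at most one. *)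
Lemma norm_sum_spread a F (ns : seq nat) (k : R) : segment_family F ->
  {in ns, forall n, fresh F n} -> uniq ns ->
  \sum_(S <- F) `|a S| `^ q <= 1 -> 0 <= k -> k `^ q * (size ns)%:R = 1 ->
  `|k *: \sum_(n <- ns) spread a F n| <= 1.
Proof.
move=> Ff Fns uns a1 k0 kns.
pose r := [seq (U, n) | U <- F, n <- ns].
apply: (@norm_molecule_le1 _ p q B pr e p1 hpq dB _ r
   (fun c => k * a c.1) (fun c => [fset child c.2 c.1]%fset)).
- apply: segment_family_map.
  + by apply: allpairs_uniq => //; [exact: segment_family_uniq|case=> ? ? []].
  + by move=> c _; exact: segment_fset1.
  + move=> c d cr dr t; rewrite !inE => /eqP tc /eqP td.
    apply: (@prefix_child F ns) cr dr _ => //.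
      by move=> S SF s sS n /Fns; apply; eassumption.
    by rewrite -tc -td prefix_refl.
- rewrite big_allpairs /=; apply: le_trans a1; apply: ler_sum => S _.
  rewrite big_const_seq count_predT iter_addr_0 normrM powRM// (ger0_norm k0).
  by rewrite -mulr_natr mulrAC kns mul1r.
- move=> u; rewrite big_allpairs /=.
  rewrite (_ : k *: _ = \sum_(n <- ns) k *: spread a F n); last by rewrite scaler_sumr.
  rewrite (pr_suml dB) exchange_big /=; apply: eq_bigr => n _.
  rewrite (pr_suml dB) mulr_sumr; apply: eq_bigr => S _.
  by rewrite big_seq_fset1 (pr_coord dB) mulrA.
Qed.

(* Otherwise the sum of [N] of the [spread a F n], whose norm is at most [N^(1/q)], would have
   a value of order [N] under [f]. *)
Lemma spread_small f a F (N0 : nat) (d : R) : segment_family F -> `|f| = 1 ->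
  \sum_(S <- F) `|a S| `^ q <= 1 -> 0 < d ->
  exists n, [/\ (N0 <= n)%N, fresh F n & - d < f (spread a F n)].
Proof.
move=> Ff f1 a1 d0; apply: contrapT => noN.
have p0 : 0 < p by exact: lt_trans p1.
have q0 : 0 < q by apply: lt_trans (conjugate_gt1 p1 hpq).
have [N1 HN1] := exists_fresh F; pose N := maxn N0 N1.
(* With [k = K^(-1/q)] one has [k * K = K^(1/p)], so [K > d^(-p)] makes [k * K * d] exceed 1,
   against the norm bound. *)
pose K := (Num.truncn ((d^-1) `^ p)).+1.
have K0 : 0 < K%:R :> R by rewrite ltr0n.
have Kd : d^-1 `^ p < K%:R by exact: truncnS_gt.
pose k : R := K%:R `^ (- q^-1).
have k0 : 0 <= k by exact: powR_ge0.
have ns n : n \in iota N K -> fresh F n.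
  by rewrite mem_iota => /andP[Nn _]; apply: HN1; apply: leq_trans Nn; exact: leq_maxr.
have kq : k `^ q * (size (iota N K))%:R = 1.
  by rewrite size_iota -powRrM mulNr mulVf ?gt_eqF// powR_inv1 ?mulVf ?gt_eqF// ltW.
have := norm_sum_spread Ff ns (iota_uniq _ _) a1 k0 kq.
set x := _ *: _ => x1.
have fx : f x = k * \sum_(n <- iota N K) (f (spread a F n) : R) :> R.
  by rewrite linearZ linear_sum.
have fxd : f x <= - (k * K%:R * d) :> R.
  rewrite fx -mulrA -mulrN; apply: ler_wpM2l => //.
  have -> : - (K%:R * d) = \sum_(n <- iota N K) (- d).
    by rewrite big_const_seq count_predT iter_addr_0 size_iota mulNrn mulr_natl.
  rewrite big_seq [leRHS]big_seq; apply: ler_sum => n nN.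
  rewrite leNgt; apply/negP => dn; apply: noN; exists n; split=> //; last exact: ns.
  move: nN; rewrite mem_iota => /andP[Nn _]; apply: leq_trans Nn.
  exact: leq_maxl.
have := dual_norm_apply f x; rewrite f1 mul1r ler_norml => /andP[fx1 _].
have kK : k * K%:R = K%:R `^ p^-1.
  rewrite -[X in _ * X]powRr1 ?(ltW K0)// /k -powRD.
    by congr (_ `^ _); move: hpq; lra.
  by apply/implyP => _; rewrite gt_eqF.
have dK : d^-1 < K%:R `^ p^-1.
  have -> : d^-1 = (d^-1 `^ p) `^ p^-1.
    by rewrite -powRrM mulfV ?gt_eqF// powRr1// invr_ge0 ltW.
  by apply: gt0_ltr_powR; rewrite ?invr_gt0 ?nnegrE ?powR_ge0.
have : 1 < k * K%:R * d by rewrite kK -ltr_pdivrMr// div1r.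
lra.
Qed.

(** One family and one pair of weights serve for arbitrarily large [n]: this leaves room to avoid a
    given finite set of nodes, or to take two different labels. *)
Lemma slice_family f (al : R) : `|f| = 1 -> 0 < al ->
  exists F a b, [/\ segment_family F, \sum_(S <- F) `|b S| `^ p = 1,
    \sum_(S <- F) a S * b S = 1 &
    forall N, exists n, [/\ (N <= n)%N, fresh F n & slice f al (extended a F n)]].
Proof.
(* Half of [al] is spent on the old segments and half on [spread]; the maximum with 0 keeps [M]
   nonnegative for the powers. *)
move=> f1 al0; pose M := Num.max (1 - al / 2) 0.
have M1 : 1 - al / 2 <= M by rewrite le_max lexx.
have [|F Ff FM] := @norm_attained_family _ p _ pr e p1 dB f M f1.
  by rewrite le_max lexx orbT gt_max ltr01 andbT; lra.
have [|a [b [a1 b1 ab aM]]] := dual_weights p1 hpq _ FM; first by rewrite le_max lexx orbT.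
exists F, a, b; split=> // N.
have a1' : \sum_(S <- F) `|a S| `^ q <= 1 by rewrite a1.
have al2 : 0 < al / 2 by lra.
have [n [Nn Fn fn]] := spread_small N Ff f1 a1' al2.
exists n; split=> //; split; first exact: norm_extended_le1.
by rewrite dual_extended//; move: M1; lra.
Qed.

Lemma bump_eq0 b F n t : n \notin t -> bump b F n t = 0 :> R.
Proof.
move=> nt; rewrite c00_sumE big1// => S _.
rewrite [LHS](_ : _ = b S * delta (child n S) t)// deltaE.
case: eqP => [tE|]; last by rewrite mulr0.
by move: nt; rewrite tE mem_rcons mem_head.
Qed.

Lemma r_BSP_of_coordinates : r_BSP B.
Proof.
move=> _ [f [al [f1 al0 ->]]].
apply: lb_le_inf.
  (* The infimum must run over a nonempty set of radii; the unit ball at 0 supplies one. *)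
  exists 1; split=> //; exists 0 => x [x1 _].
  by rewrite closed_ballE// /closed_ball_ /= sub0r normrN.
move=> r [r0 [x xr]]; apply/ler_addgt0Pr => d d0.
have [F [a [b [Ff b1 ab slF]]]] := slice_family f1 al0.
(* The centre [x] is replaced by a finite combination [z]; a label absent from its nodes makes the
   bump vanish against [z]. *)
have [s] := coord_dense dB x d0; set z := \sum_(c <- s) _ => xz.
have [N HN] := ex_fresh (map snd s).
have [n [Nn Fn sl]] := slF N.
have := xr _ sl; rewrite closed_ballE// /closed_ball_ /= => xn.
have u1 : jt_norm p (bump b F n) <= 1.
  have := @jt_norm_bumps b F [:: n] (fun=> 1) 1 Ff.
  rewrite !big_seq1 scale1r normr1 powR1; apply=> // k.
  by rewrite inE => /eqP ->.
have zu : pr z (bump b F n) = 0.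
  rewrite (pr_suml dB) big1_seq// => c /= cs.
  by rewrite (pr_coord dB) bump_eq0 ?mulr0// HN// map_f.
have h1 := pr_le dB (extended a F n - x) (bump b F n).
have h2 := pr_le dB (x - z) (bump b F n).
rewrite !(prBl dB) pr_extended_bump// eqxx mul1r ab in h1.
rewrite !(prBl dB) zu subr0 in h2.
have h3 : 1 - pr x (bump b F n) <= r.
  apply: le_trans (ler_norm _) _; apply: le_trans h1 _.
  rewrite distrC; apply: le_trans xn; rewrite -[leRHS]mulr1.
  by rewrite ler_wpM2l.
have h4 : pr x (bump b F n) <= d.
  apply: le_trans (ler_norm _) _; apply: le_trans h2 _; apply: ltW.
  by apply: le_lt_trans xz; rewrite -[leRHS]mulr1 ler_wpM2l.
lra.
Qed.

Lemma diam_slice_ge (S : set B) : is_slice S -> 2 `^ q^-1 <= diam S.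
Proof.
move=> [f [al [f1 al0 ->]]].
have p0 : 0 < p by exact: lt_trans p1.
have [F [a [b [Ff b1 ab slF]]]] := slice_family f1 al0.
have [n [_ Fn sn]] := slF 0%N; have [k [nk Fk sk]] := slF n.+1.
have kn : (k == n) = false by rewrite gtn_eqF.
apply: (@le_trans _ _ `|extended a F n - extended a F k|); last first.
  apply: sup_upper_bound; last by exists (extended a F n) => //; exists (extended a F k).
  split; first by exists `|extended a F n - extended a F k|, (extended a F n) => //;
    exists (extended a F k).
  exists 2 => _ [x [x1 _] [y [y1 _] <-]].
  by apply: le_trans (ler_normB _ _) _; have := lerD x1 y1; lra.
(* The signs (1, -1) have l_p norm [2^(1/p)], while the difference of the two molecules takes the
   value 2 on the difference of the bumps. *)
pose g (j : nat) : R := if j == n then 1 else -1.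
have := @jt_norm_bumps b F [:: n; k] g (2 `^ p^-1) Ff.
rewrite !big_cons !big_nil !addr0 /g eqxx kn normr1 normrN1 powR1 -powRrM.
rewrite mulVf ?gt_eqF// powRr1// => /(_ _ _ b1 (powR_ge0 _ _) _).
move=> u2.
have {}u2 : jt_norm p (1 *: bump b F n + -1 *: bump b F k) <= 2 `^ p^-1.
  apply: u2 => //; first by move=> j; rewrite !inE => /orP[] /eqP ->.
  by rewrite /= inE eq_sym kn.
have h := pr_le dB (extended a F n - extended a F k)
  (1 *: bump b F n + -1 *: bump b F k).
have pu x : pr x (1 *: bump b F n + -1 *: bump b F k) =
    pr x (bump b F n) - pr x (bump b F k).
  have <- : \sum_(j <- [:: n; k]) g j *: bump b F j =
      1 *: bump b F n + -1 *: bump b F k.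
    by rewrite !big_cons big_nil addr0 /g eqxx kn.
  by rewrite (pr_sumr dB) !big_cons big_nil addr0 /g eqxx kn mul1r mulN1r.
rewrite (prBl dB) !pu !pr_extended_bump// !eqxx kn eq_sym kn ab !mulr1 /= subr0 sub0r opprK in h.
have {}h : 2 <= `|extended a F n - extended a F k| * 2 `^ p^-1.
  apply: le_trans (_ : _ <= `|extended a F n - extended a F k| * _) _; last first.
    by apply: ler_wpM2l u2.
  by apply: le_trans h; apply: le_trans (ler_norm _); lra.
have two : 2 `^ q^-1 * 2 `^ p^-1 = 2 :> R.
  by rewrite -powRD ?pnatr_eq0 ?implybT// (addrC q^-1) hpq powRr1.
have t0 : 0 < 2 `^ p^-1 :> R by exact: powR_gt0.
by rewrite -(ler_pM2r t0) two.
Qed.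

End BigSlices.

(** * Upper bound: the slice given by evaluation at the root *)

Section SmallSlice.
Context {R : realType} (p q : R).
Hypotheses (p1 : 1 < p) (hpq : p^-1 + q^-1 = 1).
Implicit Types (u : c00 (seq nat) R) (S : {fset seq nat}) (F : seq {fset seq nat}).

(** From [(y + d)^p >= y^p + d * y^(p-1)]; the threshold [d^(-1/(p-1))] makes the last term at least
    1. It serves to absorb the segments that miss the root. *)
Lemma powR_gap (d : R) : 0 < d ->
  exists2 Y : R, 1 <= Y & forall y, Y <= y -> y `^ p + 1 <= (y + d) `^ p.
Proof.
move=> d0; have p0 : 0 < p by exact: lt_trans p1.
have p10 : 0 < p - 1 by rewrite subr_gt0.
exists (Num.max 1 (d^-1 `^ (p - 1)^-1)); first by rewrite le_max lexx.
move=> y; rewrite ge_max => /andP[y1 yd].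
have y0 : 0 <= y by lra.
have yd0 : 0 <= y + d by lra.
rewrite -(mulr_powRB1 y0 p0) -(mulr_powRB1 yd0 p0).
apply: (@le_trans _ _ ((y + d) * y `^ (p - 1))).
  rewrite mulrDl lerD2l -ler_pdivrMl// mulr1.
  have <- : (d^-1 `^ (p - 1)^-1) `^ (p - 1) = d^-1.
    by rewrite -powRrM mulVf ?gt_eqF// powRr1// invr_ge0 ltW.
  by apply: ge0_ler_powR; rewrite ?nnegrE ?powR_ge0// ltW.
by apply: ler_wpM2l => //; apply: ge0_ler_powR; rewrite ?nnegrE//; lra.
Qed.

Lemma le_abs_of_powR_le1 (x : R) : `|x| `^ p <= 1 -> `|x| <= 1.
Proof.
have p0 : 0 < p by exact: lt_trans p1.
apply: contraTT; rewrite -!ltNge => x1.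
have <- : 1 `^ p = 1 :> R by rewrite powR1.
by apply: gt0_ltr_powR; rewrite ?nnegrE.
Qed.

Definition root : seq nat := [::].

(** A segment through the root is prefix-closed, so above a node outside [S'] there is no node of
    [S']. *)
Lemma segment_fsetD S S' : segment S -> segment S' -> root \in S' ->
  (S `\` S')%fset != fset0 -> segment (S `\` S')%fset.
Proof.
move=> [_ cS iS] [_ _ iS'] rS' SS'; split=> // [s t|s t u].
  by rewrite !inE => /andP[_ sS] /andP[_ tS]; exact: cS.
rewrite !inE => /andP[sS' sS] /andP[_ uS] st tu; rewrite (iS s t u) ?andbT//.
by apply: contra sS' => tS'; apply: (iS' root s t); rewrite ?prefix0s.
Qed.

(** The condition [jt_norm p u <= 1] unfolded to family sums, a form that passes at once from [u] to
    [- u]. *)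
Definition unit_bounded u := forall F, segment_family F ->
  \sum_(S <- F) `|\sum_(t <- S) (u t : R)| `^ p <= 1.

Lemma unit_bounded_segment u S : unit_bounded u -> segment S ->
  `|\sum_(t <- S) (u t : R)| <= 1.
Proof.
move=> u1 sS; apply: le_abs_of_powR_le1; have := u1 [:: S]; rewrite big_seq1; apply.
by split=> // S'; rewrite inE => /eqP ->.
Qed.

(** The common part cancels, leaving two disjoint differences that are segments or empty; their sums
    [x] and [y] satisfy [|x|^p + |y|^p <= 1]. *)
Lemma unit_bounded_sub u S S' : unit_bounded u -> segment S -> segment S' ->
  root \in S -> root \in S' ->
  \sum_(t <- S) (u t : R) - \sum_(t <- S') (u t : R) <= 2 `^ q^-1.
Proof.
move=> u1 sS sS' rS rS'; have p0 : 0 < p by exact: lt_trans p1.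
have q0 : 0 < q by apply: lt_trans (conjugate_gt1 p1 hpq).
have splitE (U V : {fset seq nat}) : \sum_(t <- U) (u t : R) =
    \sum_(t <- (U `&` V)%fset) (u t : R) + \sum_(t <- (U `\` V)%fset) (u t : R).
  rewrite (bigID (mem V)) /=; congr (_ + _); rewrite -big_filter;
    apply/perm_big/uniq_perm; rewrite ?filter_uniq ?fset_uniq// => t.
    by rewrite mem_filter !inE andbC.
  by rewrite mem_filter !inE.
rewrite (splitE S S') (splitE S' S) fsetIC.
set x := \sum_(t <- (S `\` S')%fset) _; set y := \sum_(t <- (S' `\` S)%fset) _.
have xy : `|x| `^ p + `|y| `^ p <= 1.
  pose L : seq {fset seq nat} := [:: (S `\` S')%fset; (S' `\` S)%fset].
  have Lf : segment_family [seq U <- L | U != fset0].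
    split=> [U|]; last first.
      apply: pairwise_filter; rewrite /= !andbT; apply/fdisjointP => t.
      by rewrite !inE => /andP[/negPf -> ->].
    rewrite mem_filter => /andP[U0]; rewrite !inE.
    by move=> /orP[] /eqP UE; rewrite UE; apply: segment_fsetD => //; rewrite -UE.
  have := u1 _ Lf; rewrite big_filter big_mkcond.
  have nz (U : {fset seq nat}) : (if U != fset0
      then `|\sum_(t <- U) (u t : R)| `^ p else 0) = `|\sum_(t <- U) (u t : R)| `^ p.
    by case: eqP => [->|//]; rewrite big_seq_fset0 normr0 powR0 ?gt_eqF.
  by rewrite (eq_bigr _ (fun U _ => nz U)) /L big_cons big_seq1.
(* Since [k^q = 1/2], Young's inequality for [|x| * k] and [|y| * k] adds up to at most
   [1/p + 1/q = 1]. *)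
pose k : R := 2 `^ (- q^-1).
have k0 : 0 < k by exact: powR_gt0.
have kq : k `^ q = 2^-1 by rewrite -powRrM mulNr mulVf ?gt_eqF// powR_inv1.
have hx := conjugate_powR (normr_ge0 x) (ltW k0) p0 q0 hpq.
have hy := conjugate_powR (normr_ge0 y) (ltW k0) p0 q0 hpq.
have : (x - y) * k <= 1.
  apply: (@le_trans _ _ (`|x| * k + `|y| * k)).
    rewrite -mulrDl ler_wpM2r// ?(ltW k0)//.
    by apply: le_trans (ler_norm _) _; exact: ler_normB.
  have xyp : (`|x| `^ p + `|y| `^ p) / p <= p^-1.
    by rewrite -[leRHS]mul1r ler_wpM2r// invr_ge0 ltW.
  by move: hx hy hpq; rewrite kq; move: xyp; lra.
have -> : \sum_(t <- (S' `&` S)%fset) (u t : R) + x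
    - (\sum_(t <- (S' `&` S)%fset) (u t : R) + y) = x - y by lra.
by rewrite -ler_pdivlMr// div1r /k -powRN opprK.
Qed.

(** At most one segment of a family contains the root. Its sum lies between [K - 1 >= Y] and
    [K + M], and the other segments add at most 1 to the p-th powers, which [Yd] absorbs into
    [d]. *)
Lemma jt_norm_root_add u (K Y d M : R) : unit_bounded u ->
  0 < d -> 1 <= Y -> (forall y, Y <= y -> y `^ p + 1 <= (y + d) `^ p) ->
  Y + 1 <= K ->
  (forall S, segment S -> root \in S -> \sum_(t <- S) (u t : R) <= M) ->
  jt_norm p (K *: delta root + u) <= K + M + d.
Proof.
move=> u1 d0 Y1 Yd YK uM; have p0 : 0 < p by exact: lt_trans p1.
(* This keeps [K + M + d] above 1, which settles families that miss the root. *)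
have M1 : - 1 <= M.
  have := uM _ (segment_fset1 root); rewrite inE eqxx => /(_ isT); apply: le_trans.
  by have := unit_bounded_segment u1 (segment_fset1 root); rewrite ler_norml => /andP[].
have sumE S : \sum_(t <- S) ((K *: delta root + u) t : R) =
    K * (root \in S)%:R + \sum_(t <- S) (u t : R).
  have := sum_delta [:: tt] (fun=> K) (fun=> root) S.
  by rewrite !big_seq1 => <-; rewrite -big_split.
apply: jt_norm_le => // [|F Ff]; first lra.
have [/hasP[S SF rS]|/hasPn nr] := boolP (has (fun S : {fset seq nat} => root \in S) F).
  have sS := Ff.1 _ SF.
  have sumS : \sum_(U <- F) `|\sum_(t <- U) ((K *: delta root + u) t : R)| `^ p =
      `|K + \sum_(t <- S) (u t : R)| `^ p +
      \sum_(U <- F | U != S) `|\sum_(t <- U) (u t : R)| `^ p.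
    rewrite (bigD1_seq S) ?segment_family_uniq//= sumE rS mulr1; congr (_ + _).
    rewrite big_seq_cond [RHS]big_seq_cond; apply: eq_bigr => U /andP[UF US].
    rewrite sumE (_ : root \in U = false) ?mulr0 ?add0r//.
    by apply: contraNF US => rU; rewrite (segment_family_inj Ff UF SF rU rS).
  have rest : \sum_(U <- F | U != S) `|\sum_(t <- U) (u t : R)| `^ p <= 1.
    apply: le_trans (u1 F Ff); rewrite [leRHS](bigID (fun U => U != S)) /= lerDl.
    by apply: sumr_ge0 => U _; exact: powR_ge0.
  rewrite sumS; apply: le_trans (lerD (lexx _) rest) _.
  have := unit_bounded_segment u1 sS; rewrite ler_norml => /andP[uS1 _].
  have uSM := uM S sS rS.
  rewrite ger0_norm; last lra.
  apply: le_trans (Yd _ _) _; first lra.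
  by apply: ge0_ler_powR; rewrite ?nnegrE; lra.
rewrite (eq_big_seq (fun U : {fset seq nat} => `|\sum_(t <- U) (u t : R)| `^ p)); last first.
  by move=> U /nr /negPf rU; rewrite sumE rU mulr0 add0r.
apply: le_trans (u1 F Ff) _.
have <- : 1 `^ p = 1 :> R by rewrite powR1.
by apply: ge0_ler_powR; rewrite ?nnegrE; lra.
Qed.

Context (B : normedModType R) (pr : B -> c00 (seq nat) R -> R) (e : seq nat -> B).
Hypothesis dB : coordinate_duality p pr e.

Lemma jt_norm_delta t : jt_norm p (delta t : c00 (seq nat) R) <= 1.
Proof.
have := @jt_norm_antichain R unit [:: tt] (fun=> 1) (fun=> t) p 1 p1.
by rewrite !big_seq1 scale1r normr1 => h; apply: h => // [[] []].
Qed.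

Lemma root_functional : exists2 f : dual B, `|f| = 1 & forall b, f b = pr b (delta root).
Proof.
pose h (b : B) : R^o := pr b (delta root).
have hl : linear h by move=> a b c; rewrite /h (pr_linearl dB).
have hb b : `|h b : R| <= 1 * `|b|.
  apply: le_trans (pr_le dB _ _) _; rewrite mulrC.
  by rewrite ler_wpM2r// jt_norm_delta.
have [f fE] := dual_of_bounded hl hb; exists f => //.
apply/eqP; rewrite eq_le; apply/andP; split.
  by apply: dual_norm_lub => b b1; rewrite fE; apply: le_trans (hb b) _; rewrite mul1r.
have := dual_norm_apply f (e root); rewrite fE /h (pr_coord dB) deltaE eqxx normr1.
move/le_trans; apply; rewrite -[leRHS]mulr1 ler_wpM2l//.
exact: (norm_coordinate p1 hpq dB).
Qed.

(* A functional [x] of norm at most one with [x(root)] close to one satisfies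
   [K x(root) + x(u) <= |K delta_root + u|], whose right-hand side is, up to a small error for
   large [K], [K] plus the largest sum of [u] over a segment through the root. *)
Lemma small_slice (eps : R) : 0 < eps ->
  exists2 S : set B, is_slice S & diam S <= 2 `^ q^-1 + eps.
Proof.
move=> eps0; have [f f1 fE] := root_functional.
(* Four errors of size [d] occur: for each of [x] and [y], one from the norm estimate and one from
   [K * al]. *)
pose d := eps / 4; have d0 : 0 < d by rewrite /d; lra.
have [Y Y1 Yd] := powR_gap d0; pose K := Y + 1.
have K0 : 0 < K by rewrite /K; lra.
pose al := d / K; have al0 : 0 < al by exact: divr_gt0.
have Kal : K * al = d by rewrite /al mulrC divfK// gt_eqF.
exists (slice f al); first by exists f, al.
have c0 : 0 <= 2 `^ q^-1 :> R by exact: powR_ge0.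
have slr : slice f al (e root).
  split; first exact: (norm_coordinate p1 hpq dB).
  by rewrite fE (pr_coord dB) deltaE eqxx ltrBlDr ltrDl.
apply: ge_sup; first by exists `|e root - e root|, (e root) => //; exists (e root).
move=> _ [x [x1 xal] [y [y1 yal] <-]]; rewrite !fE in xal yal.
apply: (norm_le_pr dB); first lra.
move=> u u1; have {}u1 : unit_bounded u.
  move=> F Ff; apply: le_trans (jt_norm_ge u p1 Ff) _.
  have <- : 1 `^ p = 1 :> R by rewrite powR1.
  by apply: ge0_ler_powR; rewrite ?nnegrE ?jt_norm_ge0 ?(ltW (lt_trans _ p1)).
have uN1 : unit_bounded (- u).
  move=> F Ff; apply: le_trans (u1 F Ff).
  rewrite (eq_bigr (fun S : {fset seq nat} => `|\sum_(t <- S) (u t : R)| `^ p))// => S _.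
  by rewrite -normrN -sumrN; congr (`|_| `^ _); apply: eq_bigr => t _; rewrite opprK.
pose E := [set \sum_(t <- S) (u t : R) | S in [set S | segment S /\ root \in S]].
have supE : has_sup E.
  split; first by eexists; exists [fset root]%fset => //; split;
    [exact: segment_fset1|rewrite inE].
  exists 1 => _ [S [sS _] <-]; apply: le_trans (ler_norm _) _.
  exact: unit_bounded_segment.
have uA S : segment S -> root \in S -> \sum_(t <- S) (u t : R) <= sup E.
  by move=> sS rS; apply: sup_upper_bound => //; exists S.
(* The bounds used for [u] and for [- u] then sum to exactly [2^(1/q)]. *)
have uNA S : segment S -> root \in S ->
    \sum_(t <- S) ((- u) t : R) <= 2 `^ q^-1 - sup E.
  move=> sS rS; have -> : \sum_(t <- S) ((- u) t : R) = - \sum_(t <- S) (u t : R).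
    by rewrite -sumrN.
  rewrite lerBrDr addrC -lerBrDr opprK addrC; apply: ge_sup; first exact: supE.1.
  by move=> _ [S' [sS' rS'] <-]; rewrite -lerBlDl; exact: unit_bounded_sub.
have YK : Y + 1 <= K by [].
have nx := jt_norm_root_add u1 d0 Y1 Yd YK uA.
have ny := jt_norm_root_add uN1 d0 Y1 Yd YK uNA.
have bnd b v : `|b| <= 1 -> pr b v <= jt_norm p v.
  move=> b1; apply: le_trans (ler_norm _) _; apply: le_trans (pr_le dB _ _) _.
  by rewrite -[leRHS]mul1r ler_wpM2r// jt_norm_ge0.
have := le_trans (bnd x _ x1) nx; have := le_trans (bnd y _ y1) ny.
rewrite !(pr_linearr dB) (prBl dB).
have -> : pr y (- u) = - pr y u.
  have := pr_linearr dB (-1) y u (- u - (-1) *: u).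
  rewrite scaleN1r opprK addNr addr0 mulN1r => ->.
  have := pr_linearr dB (-1) y 0 0; rewrite scaler0 addr0 => ->.
  by rewrite mulN1r addNr addr0.
have Kx : K * (1 - al) <= K * pr x (delta root) by rewrite ler_pM2l// ltW.
have Ky : K * (1 - al) <= K * pr y (delta root) by rewrite ler_pM2l// ltW.
rewrite mulrBr mulr1 Kal in Kx Ky.
have dE : d * 4 = eps by rewrite /d divfK.
move: Kx Ky dE; clearbody al d K.
move: (K * pr x _) (K * pr y _) (pr x u) (pr y u) (sup E) (2 `^ _).
clear; move=> k1 k2 k3 k4 k5 k6 *. lra.
Qed.

End SmallSlice.

(** * The three statements for [B_infty] *)

Theorem theorem3p1 (R : realType) (p q : R) (hp : 1 < p)
    (hpq : p^-1 + q^-1 = 1)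
    (X : completeNormedModType R) (J : {linear c00 (seq nat) R -> X})
    (hJ : is_JT p J) :
  [/\ r_BSP (B_infty J),
      forall S : set (B_infty J), is_slice S -> 2 `^ q^-1 <= diam S &
      forall e : R, 0 < e ->
        exists2 S : set (B_infty J), is_slice S & diam S <= 2 `^ q^-1 + e].
Proof.
have [e eE] := exists_coordinates hp hJ.
have dB : coordinate_duality p (@pairing R X J) e.
  split; [exact: pairing_linearl|exact: pairing_linearr|exact: pairing_le
    |exact: norm_le_pairing|exact: eE|].
  by move=> z d d0; exact: (coordinates_dense hJ z eE d0).
split; first exact: (r_BSP_of_coordinates hp hpq dB).
  exact: (diam_slice_ge hp hpq dB).
exact: (small_slice hp hpq dB).
Qed.
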